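(* Let $\mathcal{X}\subseteq\mathbb{R}^n$ be a compact set, let $\phi:\mathbb{R}^n\to\mathbb{R}$ be convex and $R:\mathbb{R}^n\to\mathbb{R}$ be concave, and let $\beta(\cdot)$, $\alpha(\cdot)$, $\underline{b}$, $\bar a$ be defined as in the context. Assume that the set $\{a\in[\alpha(\underline{b}),\bar a]:\beta(a)>\underline{b}\}$ is non-empty, and let $$\underline{a}=\inf\{a\in[\alpha(\underline{b}),\bar a]:\beta(a)>\underline{b}\}.$$ Then $a=\alpha(\beta(a))$ for any $a\in[\underline{a},\bar a]$.
   Context: The set $\mathcal{X}$ represents the admissible portfolios, $\phi(x)$ measures the risk and $R(x)$ the reward of a portfolio $x\in\mathbb{R}^n$. For $a,b\in\mathbb{R}$ define $$\beta(a)=\min\{\phi(x): R(x)\ge a,\ x\in\mathcal{X}\},\qquad \alpha(b)=\max\{R(x): \phi(x)\le b,\ x\in\mathcal{X}\},$$ with the convention $\beta(a)=+\infty$ (resp. $\alpha(b)=-\infty$) if the corresponding problem is infeasible. Define also $$\underline{b}=\min\{\phi(x): x\in\mathcal{X}\},\qquad \bar a=\max\{R(x): x\in\mathcal{X}\}.$$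
   Formalization: The admissible set is assumed convex as well as compact; for compact sets alone the claim fails, e.g. for the set {0,1} in dimension 1 with φ(x) = R(x) = x, where β(1/2) = 1 and α(1) = 1 ≠ 1/2. *)

(* Defs.v *)
From HB Require Import structures.
From mathcomp Require Import all_boot all_order all_algebra.
From mathcomp Require Import all_classical all_reals all_analysis.

Set Implicit Arguments.
Unset Strict Implicit.
Unset Printing Implicit Defensive.

Import Order.TTheory GRing.Theory Num.Theory.
Import numFieldNormedType.Exports.

Local Open Scope classical_set_scope.
Local Open Scope ring_scope.

Definition concave_function (R : realType) (E : lmodType R)
    (D : set (convex_lmodType E)) (f : convex_lmodType E -> R^o) :=
  convex_function D (fun x => - f x).

(* [emin A] is the least element of [A], not its infimum: if [A] has no least
   element (in particular if [A] is empty) the value is [+oo].  Dually for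
   [emax], with [-oo]. *)
Definition emin (R : realType) (A : set (\bar R)) : \bar R :=
  xget +oo%E (A `&` lbound A).

Definition emax (R : realType) (A : set (\bar R)) : \bar R :=
  xget -oo%E (A `&` ubound A).

(* Compactness of the admissible set [X] alone does not give
   [a = alpha (beta a)]: for [X = {0, 1}] in dimension 1 and
   [phi x = rew x = x], [beta (1/2) = 1] and [alpha 1 = 1].  [X] is therefore
   taken convex as well. *)
Section EfficientFrontier.
Context (R : realType) (n : nat).
Variables (X : set 'rV[R]_n) (phi rew : 'rV[R]_n -> R).

Definition beta (a : R) : \bar R :=
  emin [set (phi x)%:E | x in [set x | a <= rew x /\ X x]].

(* The argument is an extended real so that [alpha (beta a)] and
   [alpha min_risk] can be formed. *)
Definition alpha (b : \bar R) : \bar R :=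
  emax [set (rew x)%:E | x in [set x | ((phi x)%:E <= b)%E /\ X x]].

Definition min_risk : \bar R := emin [set (phi x)%:E | x in X].

Definition max_reward : \bar R := emax [set (rew x)%:E | x in X].

Definition risky_levels : set R :=
  [set a | (alpha min_risk <= a%:E)%E /\ (a%:E <= max_reward)%E
           /\ (min_risk < beta a)%E].

End EfficientFrontier.

(* Main.v *)
(* If [x] is optimal for [beta a] and [y] is optimal for [alpha (phi x)] with
   [rew y > a], then [y] has slack in the constraint [rew >= a].  When
   [phi x > min_risk], moving [y] slightly towards a minimizer of the risk keeps
   [rew >= a] and brings the risk strictly below [phi x], a contradiction.  When
   [phi x = min_risk], [rew y <= alpha min_risk <= inf risky_levels <= a].  The
   optimizers exist by compactness, since a finite convex function on [R^n] is
   continuous. *)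
Require Import Defs.
From mathcomp Require Import all_boot all_order all_algebra.
From mathcomp Require Import all_classical all_reals all_analysis.
From mathcomp Require Import lra ring.

Set Implicit Arguments.
Unset Strict Implicit.
Unset Printing Implicit Defensive.

Import Order.TTheory GRing.Theory Num.Theory.
Import numFieldNormedType.Exports.

Local Open Scope classical_set_scope.
Local Open Scope ring_scope.

Lemma convex_functionP (R : realType) (E : lmodType R) (f : E -> R) (x y : E)
    (t : R) :
  convex_function [set: convex_lmodType E] f -> 0 <= t <= 1 ->
  f (t *: x + (1 - t) *: y) <= t * f x + (1 - t) * f y.
Proof.
move=> cf /andP[t0 t1].
exact: (cf (Itv01 t0 t1) x y (in_setT _) (in_setT _)).
Qed.

Lemma convex_setP (R : realType) (E : lmodType R) (X : set E) (x y : E)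
    (t : R) :
  convex_set (X : set (convex_lmodType E)) -> 0 <= t <= 1 -> X x -> X y ->
  X (t *: x + (1 - t) *: y).
Proof.
move=> cX /andP[t0 t1] Xx Xy.
by have := cX x y (Itv01 t0 t1) (mem_set Xx) (mem_set Xy); rewrite inE.
Qed.

(** Jensen's inequality with equal weights. The mean of [m.+2] points is the convex combination of
    the last point, with weight [t = 1 / (m + 2)], and the mean of the others;
    [(1 - t) / (m + 1) = t] makes all weights equal. *)
Lemma convex_function_mean (R : realType) (E : lmodType R) (f : E -> R)
    (m : nat) (x : nat -> E) :
  convex_function [set: convex_lmodType E] f ->
  f (m.+1%:R^-1 *: \sum_(i < m.+1) x i)
    <= m.+1%:R^-1 * \sum_(i < m.+1) f (x i).
Proof.
move=> cf; elim: m => [|m IH]; first by rewrite !big_ord1 invr1 scale1r mul1r.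
rewrite !(big_ord_recr m.+1) /=.
set S := \sum_(i < m.+1) x i; set T := \sum_(i < m.+1) f (x i).
have k0 : 0 < m.+1%:R :> R by rewrite ltr0n.
have k1E : m.+2%:R = m.+1%:R + 1 :> R by rewrite -natr1.
rewrite k1E; move: (m.+1%:R : R) IH k0 {k1E} => k IH k0.
have k1n0 : k + 1 != 0 by lra.
have kn0 : k != 0 by lra.
pose t : R := (k + 1)^-1.
have t01 : 0 <= t <= 1 by rewrite /t invr_ge0 invf_le1; lra.
have tE : (1 - t) * k^-1 = t by rewrite /t; field; rewrite k1n0 kn0.
have fS := convex_functionP (x m.+1) (k^-1 *: S) cf t01.
rewrite scalerA tE -scalerDr [x _ + S]addrC in fS; apply: (le_trans fS).
have t1 : 0 <= 1 - t by lra.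
have := ler_wpM2l t1 IH; rewrite mulrA tE -/t -/S -/T; lra.
Qed.

(** The point [x + s *: v] lies between [x] and either [x + v] or [x - v], according to the sign of
    [s]. Adding both absolute increments gives one bound for both signs. *)
Lemma convex_function_segment (R : realType) (E : lmodType R) (f : E -> R)
    (x v : E) (s : R) :
  convex_function [set: convex_lmodType E] f -> `|s| <= 1 ->
  f (x + s *: v) - f x
    <= `|s| * (`|f (x + v) - f x| + `|f (x - v) - f x|).
Proof.
move=> cf s1.
have key w : f (x + `|s| *: w) - f x <= `|s| * (f (x + w) - f x).
  have := convex_functionP (x + w) x cf (_ : 0 <= `|s| <= 1).
  rewrite normr_ge0 s1 => /(_ isT).
  have -> : `|s| *: (x + w) + (1 - `|s|) *: x = x + `|s| *: w.
    by rewrite scalerDr scalerBl scale1r addrC addrA subrK.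
  lra.
have [s0|s0] := leP 0 s.
  have := key v; rewrite ger0_norm // => /le_trans; apply.
  by apply: ler_wpM2l => //; rewrite (le_trans (ler_norm _)) // lerDl.
have := key (- v); rewrite ltr0_norm // scalerN scaleNr opprK => /le_trans.
apply; apply: ler_wpM2l; first by rewrite oppr_ge0 ltW.
by rewrite (le_trans (ler_norm _)) // lerDr.
Qed.

(* [x + d] is the mean of the [n] points [x + n d_i e_i], each of which lies on
   a fixed segment with midpoint [x]. *)
Lemma convex_function_local_bound (R : realType) (n : nat)
    (f : 'rV[R]_n -> R) (x : 'rV[R]_n) :
  convex_function [set: convex_lmodType 'rV[R]_n] f ->
  exists2 M : R, 0 <= M &
    forall d, n%:R * `|d| <= 1 -> f (x + d) - f x <= M * `|d|.
Proof.
case: n f x => [|m] f x cf.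
  (* In dimension 0 the only displacement is 0. *)
  by exists 0 => // d _; rewrite (thinmx0 d) addr0 subrr mul0r.
pose e (i : nat) : 'rV[R]_m.+1 := delta_mx 0 (inord i).
pose B i : R := `|f (x + e i) - f x| + `|f (x - e i) - f x|.
exists (\sum_(i < m.+1) B i) => [|d d1].
  by apply: sumr_ge0 => i _; rewrite addr_ge0.
set k : R := m.+1%:R in d1.
have k0 : 0 < k by rewrite ltr0n.
have kn0 : k != 0 by rewrite gt_eqF.
have di (i : 'I_m.+1) : `|d 0 i| <= `|d|.
  rewrite [leRHS]/Num.Def.normr /= mx_normrE.
  by apply/bigmax_geP; right; exists (0, i).
have dE : x + d =
    k^-1 *: \sum_(i < m.+1) (x + (k * d 0 (inord i)) *: e i).
  rewrite big_split /= sumr_const card_ord -scaler_nat scalerDr scalerA.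
  rewrite mulVf // scale1r {1}[d]row_sum_delta scaler_sumr; congr (_ + _).
  apply: eq_bigr => i _.
  by rewrite scalerA mulrA mulVf // mul1r /e inord_val.
have /= := convex_function_mean m (fun i => x + (k * d 0 (inord i)) *: e i) cf.
rewrite -/k -dE => fd.
have {}fd : f (x + d) - f x <= k^-1 *
    \sum_(i < m.+1) (f (x + (k * d 0 (inord i)) *: e i) - f x).
  rewrite sumrB sumr_const card_ord -mulr_natl mulrBr mulrA mulVf // mul1r.
  by rewrite lerD2r.
apply: (le_trans fd).
(* Since [k * |d_i| <= k * |d| <= 1], the segment estimate applies to each term, and its factor [k]
   cancels the [k^-1] of the mean. *)
rewrite mulr_suml mulr_sumr; apply: ler_sum => i _.
have B0 : 0 <= B i by rewrite addr_ge0.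
have kd : `|k * d 0 (inord i)| <= k * `|d|.
  by rewrite normrM gtr0_norm // ler_wpM2l // ltW.
rewrite ler_pdivrMl // mulrCA [leRHS]mulrC.
apply: le_trans (convex_function_segment x (e i) cf (le_trans kd d1)) _.
by rewrite -/(B i) ler_wpM2r.
Qed.

(** The local bound controls [f y - f x] from above. For the other side, [x] is the midpoint of [y]
    and its reflection [x + (x - y)], so an upper bound at the reflection yields a lower bound at
    [y]. *)
Lemma convex_function_continuous (R : realType) (n : nat)
    (f : 'rV[R]_n -> R) :
  convex_function [set: convex_lmodType 'rV[R]_n] f -> continuous f.
Proof.
move=> cf x; have [M M0 fM] := convex_function_local_bound x cf.
apply/(@cvgrPdist_le _ _ _ _ (nbhs_filter x)) => /= e e0.
(* [n.+1] and [M + 1] keep both quotients meaningful when [n = 0] or [M = 0]. *)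
pose r := Num.min (n.+1%:R^-1) (e / (M + 1)).
have r0 : 0 < r by rewrite lt_min invr_gt0 ltr0n divr_gt0 // ltr_wpDl.
apply/nbhs_ballP; exists r => //= y; rewrite -ball_normE /= => xy.
have [yn ye] : `|x - y| < n.+1%:R^-1 /\ `|x - y| < e / (M + 1).
  by apply/andP; rewrite -lt_min.
have nd : n%:R * `|x - y| <= 1.
  rewrite (le_trans (ler_wpM2l _ (ltW yn))) //.
  by rewrite ler_pdivrMr ?ltr0n // mul1r ler_nat.
have Md : M * `|x - y| <= e.
  move: ye; rewrite ltr_pdivlMr ?ltr_wpDl //; have := normr_ge0 (x - y); nra.
have up : f y - f x <= e.
  have := fM (y - x); rewrite [x + _]addrC subrK distrC.
  by move=> /(_ nd) /le_trans; apply.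
have down : f (x + (x - y)) - f x <= e by exact: le_trans (fM _ nd) Md.
have h01 : 0 <= (2^-1 : R) <= 1 by lra.
have mid : f x <= 2^-1 * f (x + (x - y)) + (1 - 2^-1) * f y.
  have := convex_functionP (x + (x - y)) y cf h01.
  suff -> : 2^-1 *: (x + (x - y)) + (1 - 2^-1) *: y = x by [].
  have -> : 1 - 2^-1 = 2^-1 :> R by lra.
  by rewrite -scalerDr -addrA subrK -mulr2n
    -[x *+ 2]scaler_nat scalerA mulVf ?scale1r; last lra.
rewrite ler_norml; apply/andP; split; lra.
Qed.

(** By antisymmetry a least element is unique, so the choice made by [xget] is forced once a
    minimizer is known. *)
Lemma emin_image (R : realType) (T : Type) (A : set T) (f : T -> R) (x : T) :
  A x -> (forall y, A y -> f x <= f y) ->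
  emin [set (f y)%:E | y in A] = (f x)%:E.
Proof.
move=> Ax fx; apply: xget_unique => [|z [[y Ay <-] lb]].
  by split=> [|_ [y Ay <-]]; [exists x | rewrite lee_fin fx].
apply/eqP; rewrite eq_le [X in _ && X]lee_fin fx // andbT.
by apply: lb; exists x.
Qed.

Lemma emax_image (R : realType) (T : Type) (A : set T) (f : T -> R) (x : T) :
  A x -> (forall y, A y -> f y <= f x) ->
  emax [set (f y)%:E | y in A] = (f x)%:E.
Proof.
move=> Ax fx; apply: xget_unique => [|z [[y Ay <-] ub]].
  by split=> [|_ [y Ay <-]]; [exists x | rewrite lee_fin fx].
by apply/eqP; rewrite eq_le lee_fin fx //=; apply: ub; exists x.
Qed.

Section Frontier.
Context (R : realType) (n : nat).
Variables (X : set 'rV[R]_n) (phi rew : 'rV[R]_n -> R).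
Hypotheses (X_compact : compact X)
  (phi_cont : continuous phi) (rew_cont : continuous rew).

(** A closed part of a compact set is compact; taking for [D] a closed half-line gives the feasible
    sets of both [beta] and [alpha]. *)
Let feasible_compact (f : 'rV[R]_n -> R) (D : set R) :
  continuous f -> closed D -> compact [set x | D (f x) /\ X x].
Proof.
move=> fc Dc; rewrite (_ : mkset _ = X `&` f @^-1` D); last first.
  by apply/seteqP; split=> x /= [].
by apply: compact_closedI => //; apply: preimage_closed => // x _; exact: fc.
Qed.

Lemma min_riskP : X !=set0 ->
  exists2 x, X x & min_risk X phi = (phi x)%:E.
Proof.
move=> X0.
have [x /set_mem Xx xmin] :=
  EVT_min_rV X0 X_compact (continuous_subspaceT phi_cont).
by exists x => //; apply: emin_image => // y /mem_set; exact: xmin.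
Qed.

Lemma betaP (a : R) : (exists2 x, X x & a <= rew x) ->
  exists2 x, [/\ X x, a <= rew x & beta X phi rew a = (phi x)%:E] &
    forall y, X y -> a <= rew y -> phi x <= phi y.
Proof.
move=> [x0 Xx0 ax0].
have F0 : [set x | a <= rew x /\ X x] !=set0 by exists x0.
have Fc := feasible_compact rew_cont (@closed_ge _ a).
have [x /set_mem [ax Xx] xmin] :=
  EVT_min_rV F0 Fc (continuous_subspaceT phi_cont).
exists x => [|y Xy ay]; last by apply: xmin; apply/mem_set.
split=> //; apply: emin_image => // y [ay Xy]; exact/xmin/mem_set.
Qed.

Lemma alphaP (b : R) : (exists2 x, X x & phi x <= b) ->
  exists2 x, [/\ X x, phi x <= b & alpha X phi rew b%:E = (rew x)%:E] &
    forall y, X y -> phi y <= b -> rew y <= rew x.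
Proof.
move=> [x0 Xx0 bx0].
have F0 : [set x | phi x <= b /\ X x] !=set0 by exists x0.
have Fc := feasible_compact phi_cont (@closed_le _ b).
have [x /set_mem [bx Xx] xmax] :=
  EVT_max_rV F0 Fc (continuous_subspaceT rew_cont).
exists x => [|y Xy yb]; last by apply: xmax; apply/mem_set.
split=> //; apply: emax_image => //= y []; rewrite lee_fin => yb Xy.
exact/xmax/mem_set.
Qed.

Lemma max_rewardP : X !=set0 ->
  exists2 x, X x & max_reward X rew = (rew x)%:E.
Proof.
move=> X0.
have [x /set_mem Xx xmax] :=
  EVT_max_rV X0 X_compact (continuous_subspaceT rew_cont).
by exists x => //; apply: emax_image => // y /mem_set; exact: xmax.
Qed.

End Frontier.

Lemma max_reward0 (R : realType) (n : nat) (rew : 'rV[R]_n -> R) :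
  max_reward set0 rew = -oo%E.
Proof. by rewrite /max_reward image_set0 /emax set0I xgetPN // => x []. Qed.

Theorem corollary1 (R : realType) (n : nat) (X : set 'rV[R]_n)
    (phi rew : 'rV[R]_n -> R)
    (X_compact : compact X)
    (X_convex : convex_set (X : set (convex_lmodType 'rV[R]_n)))
    (phi_convex : convex_function [set: convex_lmodType 'rV[R]_n] phi)
    (rew_concave : concave_function [set: convex_lmodType 'rV[R]_n] rew)
    (risky_nonempty : risky_levels X phi rew !=set0) :
  forall a : R,
    inf (risky_levels X phi rew) <= a -> (a%:E <= max_reward X rew)%E ->
    a%:E = alpha X phi rew (beta X phi rew a).
Proof.
move=> a inf_a a_max.
have phi_cont := convex_function_continuous phi_convex.
have rew_cont : continuous rew.
  rewrite -(opprK rew) => x.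
  by apply: continuousN; exact: (@convex_function_continuous _ _ _ rew_concave).
have X0 : X !=set0.
  (* For empty [X] the default value [-oo] of [emax] contradicts the real lower bound [a]. *)
  by apply/set0P/eqP => XE; move: a_max; rewrite XE max_reward0 leeNy_eq.
have [xm Xxm xmE] := max_rewardP X_compact rew_cont X0.
rewrite xmE lee_fin in a_max.
have [x0 Xx0 x0E] := min_riskP X_compact phi_cont X0.
have [x [Xx ax ->] x_min] := betaP X_compact phi_cont rew_cont
  (ex_intro2 _ _ xm Xxm a_max).
have [y [Xy yx ->] y_max] := alphaP X_compact phi_cont rew_cont
  (ex_intro2 _ _ x Xx (lexx (phi x))).
(* One inequality is immediate: [x] is feasible for [alpha (phi x)], so [a <= rew x <= rew y]. *)
congr (_%:E); apply/eqP; rewrite eq_le (le_trans ax (y_max _ Xx _)) //=.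
rewrite leNgt; apply/negP => ay.
have [x0x|xx0] := ltP (phi x0) (phi x); last first.
  have [z [_ _ zE] z_max] := alphaP X_compact phi_cont rew_cont
    (ex_intro2 _ _ x0 Xx0 (lexx (phi x0))).
  (* [rew z] is [alpha min_risk], a lower bound of the risky levels by definition; non-emptiness
     lets it pass to the infimum. *)
  have : rew z <= inf (risky_levels X phi rew).
    apply: lb_le_inf => // c [+ _].
    by rewrite x0E zE lee_fin.
  have := z_max y Xy (le_trans yx xx0); lra.
(* [D] is positive and exceeds [rew y - rew x0], so moving by [t] from [y] towards [x0] costs at
   most [t * D <= rew y - a] of reward. *)
pose D := 1 + `|rew y - rew x0|.
have D0 : 0 < D by rewrite ltr_wpDr.
pose t := Num.min 1 ((rew y - a) / D).
have t0 : 0 < t by rewrite lt_min ltr01 divr_gt0 // subr_gt0.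
have t1 : t <= 1 by rewrite ge_min lexx.
have tD : t * D <= rew y - a by rewrite -ler_pdivlMr // ge_min lexx orbT.
have t01 : 0 <= t <= 1 by rewrite ltW.
have := convex_functionP x0 y phi_convex t01.
have /= := convex_functionP x0 y rew_concave t01.
have Xw := convex_setP X_convex t01 Xx0 Xy.
set w := t *: x0 + (1 - t) *: y in Xw * => rew_w phi_w.
have aw : a <= rew w.
  have := ler_norm (rew y - rew x0); rewrite /D in tD; nra.
(* [phi w <= t * phi x0 + (1 - t) * phi y < phi x], because [t > 0], [phi x0 < phi x] and
   [phi y <= phi x]. *)
have := x_min w Xw aw; nra.
Qed.
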